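(* Let $1\le M\le L$, $1\le l_1<\dots<l_M\le L$, $\nu_1,\dots,\nu_M\in\Lambda$, and assume $b_-(\xi_i,\xi_j)\ne0$ for all $i\neq j$. Then the domain wall partition function of type $C$, $$Z^{(C)}_M(\{\nu\},\{\xi_l\})=\langle0|C_{l_1\dots l_M}(\nu_M)\cdots C_{l_1\dots l_M}(\nu_1)|1\rangle,$$ is given by $$Z^{(C)}_M(\{\nu\},\{\xi_l\})=\sum_{\sigma\in S_M}\ \prod_{i=1}^Mc_-(\nu_i,\xi_{l_{\sigma_i}})\prod_{1\le j<k\le M}\frac{b_-(\nu_k,\xi_{l_{\sigma_j}})\,a_-(\nu_j,\xi_{l_{\sigma_k}})\,\theta(\xi_{l_{\sigma_k}},\xi_{l_{\sigma_j}})}{b_-(\xi_{l_{\sigma_k}},\xi_{l_{\sigma_j}})}.$$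
   Context: Weights. Let $\Lambda$ be a set and $a_-,b_\pm,c_\pm:\Lambda\times\Lambda\to\mathbb C$ functions. Let $R(\lambda_1,\lambda_2)\in\mathrm{End}(\mathbb C^2\otimes\mathbb C^2)$ be, in the ordered basis $(e_1\otimes e_1,e_1\otimes e_2,e_2\otimes e_1,e_2\otimes e_2)$, $$R=\begin{pmatrix}1&0&0&0\\0&b_+&c_+&0\\0&c_-&b_-&0\\0&0&0&a_-\end{pmatrix}(\lambda_1,\lambda_2).$$ For labelled copies $V_i\cong\mathbb C^2$, $R_{ij}(\lambda,\lambda')$ denotes $R(\lambda,\lambda')$ acting on $V_i\otimes V_j$ (first tensor factor $=V_i$, second $=V_j$) and trivially elsewhere. Standing assumptions, for all $\lambda_i\in\Lambda$: unitarity $R_{12}(\lambda_1,\lambda_2)R_{21}(\lambda_2,\lambda_1)=I$, and the Yang-Baxter equation $R_{12}(\lambda_1,\lambda_2)R_{13}(\lambda_1,\lambda_3)R_{23}(\lambda_2,\lambda_3)=R_{23}(\lambda_2,\lambda_3)R_{13}(\lambda_1,\lambda_3)R_{12}(\lambda_1,\lambda_2)$. (Unitarity gives $a_-(\lambda,\lambda')a_-(\lambda',\lambda)=1$.) Fix $\xi_1,\dots,\xi_L\in\Lambda$, $\xi_i$ attached to $V_i$. With an auxiliary space $V_a\cong\mathbb C^2$, $R_{a l_M}(\nu,\xi_{l_M})\cdots R_{a l_1}(\nu,\xi_{l_1})=\begin{pmatrix}A_{l_1\dots l_M}(\nu)&B_{l_1\dots l_M}(\nu)\\C_{l_1\dots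 l_M}(\nu)&D_{l_1\dots l_M}(\nu)\end{pmatrix}_a$, a $2\times 2$ matrix in $V_a$ with entries in $\mathrm{End}(V_{l_1}\otimes\dots\otimes V_{l_M})$. Reference states on $V_{l_1}\otimes\dots\otimes V_{l_M}$: $|1\rangle=\bigotimes_i e_2$, and $\langle0|$ is the transpose of $\bigotimes_i e_1$. The function $\theta$ depends on the order of the indices: $\theta(\xi_i,\xi_j)=a_-(\xi_i,\xi_j)$ if $i<j$ and $\theta(\xi_i,\xi_j)=1$ if $i\ge j$. For $\sigma\in S_M$, $\sigma_i=\sigma(i)$. *)

(* Defs.v *)
From HB Require Import structures.
From mathcomp Require Import all_boot all_order all_fingroup all_algebra.
From mathcomp Require Import reals.
From mathcomp Require Import complex mxtens.

Set Implicit Arguments.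
Unset Strict Implicit.
Unset Printing Implicit Defensive.

Import GRing.Theory.
Local Open Scope ring_scope.

(* Basis of the tensor product of copies V_i = C^2, i : I: the configuration   *)
(* s stands for the tensor product over i of e_(s i), with e_1, e_2 indexed    *)
(* by 0, 1 : 'I_2.                                                             *)
Notation cfg I := {ffun I -> 'I_2}.

(* End of that tensor product: matrices acting on column vectors, whose rows   *)
(* and columns are numbered by enum_rank : cfg I -> 'I_#|cfg I|.               *)
Notation tensEnd C I := 'M[C]_#|{: cfg I}|.

Section Defs.

Variables (C : fieldType) (Lambda : Type).

(* Row and column 2 * i + j correspond to e_(i+1) (x) e_(j+1), for i, j in     *)
(* {0, 1}; this is the numbering of mxtens_index.                              *)
Definition Rmat (am bp bm cp cm : Lambda -> Lambda -> C) (x y : Lambda) :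
    'M[C]_(2 * 2) :=
  \matrix_(p, q) nth 0 (nth [::]
    [:: [:: 1;      0;      0;      0];
        [:: 0; bp x y; cp x y;      0];
        [:: 0; cm x y; bm x y;      0];
        [:: 0;      0;      0; am x y]] p) q.

(* X acting on V_i (x) V_j (first factor V_i, second V_j) and trivially on the *)
(* other factors; only meaningful for i != j.                                  *)
Definition act2 (I : finType) (i j : I) (X : 'M[C]_(2 * 2)) : tensEnd C I :=
  \matrix_(p, q)
    let s : cfg I := enum_val p in
    let t : cfg I := enum_val q in
    X (mxtens_index (s i, s j)) (mxtens_index (t i, t j))
    * [forall k, (k != i) ==> (k != j) ==> (s k == t k)]%:R.

Variable (Rm : Lambda -> Lambda -> 'M[C]_(2 * 2)).

Definition unitarity : Prop :=
  forall x1 x2 : Lambda,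
    act2 (0 : 'I_2) 1 (Rm x1 x2) *m act2 1 0 (Rm x2 x1) = 1%:M.

Definition yang_baxter : Prop :=
  forall x1 x2 x3 : Lambda,
    let R12 := act2 (0 : 'I_3) 1 (Rm x1 x2) in
    let R13 := act2 (0 : 'I_3) 2 (Rm x1 x3) in
    let R23 := act2 (1 : 'I_3) 2 (Rm x2 x3) in
    R12 *m R13 *m R23 = R23 *m R13 *m R12.

(* None is the auxiliary space V_a and Some k is V_(l_(k+1)), k : 'I_M. The    *)
(* products below run over rev_ord k, so the factor of largest index is        *)
(* leftmost.                                                                   *)
Definition monodromy (L M : nat) (xi : 'I_L -> Lambda) (l : 'I_M -> 'I_L)
    (nu : Lambda) : tensEnd C (option 'I_M) :=
  \prod_(k < M) act2 None (Some (rev_ord k)) (Rm nu (xi (l (rev_ord k)))).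

Definition aux_cfg (I : finType) (al : 'I_2) (s : cfg I) : cfg (option I) :=
  [ffun x => oapp s al x].

(* Entry (al, be) of T seen as a 2 x 2 matrix in the auxiliary space, with     *)
(* entries in the endomorphisms of the remaining factors.                      *)
Definition aux_entry (I : finType) (T : tensEnd C (option I)) (al be : 'I_2) :
    tensEnd C I :=
  \matrix_(p, q)
    T (enum_rank (aux_cfg al (enum_val p))) (enum_rank (aux_cfg be (enum_val q))).

Definition Cop (L M : nat) (xi : 'I_L -> Lambda) (l : 'I_M -> 'I_L)
    (nu : Lambda) : tensEnd C 'I_M :=
  aux_entry (monodromy xi l nu) 1 0.

Definition tens_vec (I : finType) (v : I -> 'cV[C]_2) : 'cV[C]_#|{: cfg I}| :=
  \col_p \prod_(i : I) v i ((enum_val p : cfg I) i) 0.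

Definition ket1 (M : nat) : 'cV[C]_#|{: cfg 'I_M}| :=
  tens_vec (fun _ : 'I_M => delta_mx 1 0).

Definition bra0 (M : nat) : 'rV[C]_#|{: cfg 'I_M}| :=
  (tens_vec (fun _ : 'I_M => delta_mx 0 0))^T.

Definition ZC (L M : nat) (xi : 'I_L -> Lambda) (l : 'I_M -> 'I_L)
    (nu : 'I_M -> Lambda) : C :=
  (bra0 M *m (\prod_(k < M) Cop xi l (nu (rev_ord k))) *m ket1 M) 0 0.

(* theta(xi_i, xi_j) depends on the indices i and j, not only on the values    *)
(* xi_i and xi_j.                                                              *)
Definition theta (am : Lambda -> Lambda -> C) (L : nat) (xi : 'I_L -> Lambda)
    (i j : 'I_L) : C :=
  if (i < j)%N then am (xi i) (xi j) else 1.

End Defs.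

(* Main.v *)
Require Import Defs.
From mathcomp Require Import all_boot all_order all_fingroup all_algebra.
From mathcomp Require Import reals.
From mathcomp Require Import complex mxtens.
From mathcomp Require Import ring.

(* By the Yang-Baxter equation, exchanging two adjacent sites in the covector  *)
(* <0|C(nu_m)...C(nu_1) amounts to acting with R on those sites. Moving a site *)
(* i in state e_1 to the last place, where it only contributes the factors     *)
(* b_-(nu_k, xi_i), turns the expansion of C(nu_1)|1> over the site flipped    *)
(* into a sum over i of smaller partition functions. The coefficient of each   *)
(* term is found by adding the sites one at a time; the new coefficient is     *)
(* then given by a partial fraction identity, which follows by induction from  *)
(* two components of the Yang-Baxter equation. Iterating over nu_1, ..., nu_M  *)
(* yields the sum over S_M.                                                    *)

Import GRing.Theory.
Local Open Scope ring_scope.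
Set Implicit Arguments.
Unset Strict Implicit.
Unset Printing Implicit Defensive.

(** [C(nu_1)] flips exactly one site of |1> to e_1, because an auxiliary state that enters as e_1
    must leave as e_2. Its expansion over the flipped site i has weights [bp] before i and [am]
    after i, and i remains in its place. If i were last, every later C would leave it in e_1 with
    factor [bm] ([bra_C_rcons0]), and the smaller partition function of the other sites would
    remain.

    To bring i to the end, [bra_C_exchange] carries R through all the rows down to <0|, which R
    fixes. Passing i across y gives the wanted term, plus one in which y is the site in e_1.
    [flip_sum] adds the sites one by one: all unwanted terms are multiples of one component, and
    their total is evaluated by [flip_coef_identity], an instance of [partial_fractions]. The
    factors [theta] arise because sites in e_2 exchange with the scalar [am].

    The resulting recursion [bra_C_recursion] chooses sigma_1 = i; iterating it, with S_(n+1) split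
    by the image of the first index, gives [bra_C_permutations]. *)

(** * The partial fraction identity *)

Section SumIdentity.
Variables (C : fieldType) (I : eqType) (f p : I -> I -> C).
Hypothesis fp_exchange : forall x y w : I, x != y -> w != y -> x != w ->
  p y w * f x y = p y w * f x w - p y x * p x w.

(* With f = a_-/b_- and p = c_-/b_-, the Yang-Baxter equation gives the        *)
(* two-site relation for q = p y, h = f^~ y as well as for q = c_-(nu, _) /    *)
(* a_-(nu, _), h = b_+(nu, _) / a_-(nu, _); the induction uses the former to   *)
(* prove the general case.                                                     *)
Lemma partial_fractions (q h : I -> C) (z : I) (s : seq I) :
  uniq (z :: s) ->
  {in z :: s &, forall x w, x != w -> q w * h x = q w * f x w - q x * p x w} ->
  q z * \prod_(k <- s) h k =
    q z * \prod_(k <- s) f k z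
    - \sum_(i <- s) q i * p i z * \prod_(k <- s | k != i) f k i.
Proof.
elim: s q h z => [|y s IHs] q h z; first by rewrite !big_nil subr0.
rewrite /= inE negb_or -!andbA => /and4P[zy zs ys us] qh.
have qhS x w : x \in s -> w \in s -> x != w ->
    q w * h x = q w * f x w - q x * p x w.
  by move=> xs ws; apply: qh; rewrite !inE ?xs ?ws !orbT.
have uzs : uniq (z :: s) by rewrite /= zs.
have IHq := IHs q h z uzs.
have {IHs} IHy := IHs (p y) (f^~ y) z uzs.
rewrite !big_cons eqxx /=.
have -> : \sum_(i <- s) q i * p i z * \prod_(k <- y :: s | k != i) f k i =
          \sum_(i <- s) q i * p i z * (f y i * \prod_(k <- s | k != i) f k i).
  rewrite big_seq [RHS]big_seq; apply: eq_bigr => i is_.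
  by rewrite big_cons; case: eqP => // yi; rewrite yi is_ in ys.
have -> : \prod_(k <- s | k != y) f k y = \prod_(k <- s) f k y.
  rewrite big_seq_cond [RHS]big_seq; apply: eq_bigl => k.
  by case: (boolP (k \in s)) => //= ks; apply: contraNneq ys => <-.
have {}IHy : p y z * \prod_(k <- s) f k y = p y z * \prod_(k <- s) f k z
    - \sum_(i <- s) p y i * p i z * \prod_(k <- s | k != i) f k i.
  apply: IHy => x w; rewrite !inE => xs ws xw; apply: fp_exchange => //.
    by case/orP: xs => [/eqP->//|xs]; apply: contraNneq ys => <-.
  by case/orP: ws => [/eqP->//|ws]; apply: contraNneq ys => <-.
rewrite mulrCA {}IHq; last first.
  by move=> x w xs ws; apply: qh; rewrite !inE orbCA -in_cons ?xs ?ws orbT.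
set S := \sum_(i <- s) q i * p i z * _.
set S2 := \sum_(i <- s) q i * p i z * (f y i * _).
(* The relation [qh] splits each [q i * h y] into a part with [f y i] and a part with the common
   factor [q y]; the latter parts are summed by the relation [IHy] for [p y]. *)
have -> : h y * (q z * (\prod_(k <- s) f k z) - S) =
    (q z * h y) * \prod_(k <- s) f k z - (S2 - q y *
     \sum_(i <- s) p y i * p i z * \prod_(k <- s | k != i) f k i).
  rewrite mulrBr mulrCA mulrA; congr (_ - _).
  rewrite /S /S2 !mulr_sumr -sumrB big_seq [RHS]big_seq.
  apply: eq_bigr => i is_.
  have yi : y != i by apply: contraNneq ys => ->.
  have := qh y i; rewrite !inE eqxx is_ !orbT => /(_ isT isT yi) E.
  transitivity ((q i * h y) * p i z * \prod_(k <- s | k != i) f k i).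
    by ring.
  by rewrite E; ring.
rewrite qh ?inE ?eqxx ?orbT 1?eq_sym //.
transitivity (q z * f y z * \prod_(k <- s) f k z - S2
  - q y * (p y z * \prod_(k <- s) f k z - 
    \sum_(i <- s) p y i * p i z * \prod_(k <- s | k != i) f k i)); first by ring.
by rewrite -IHy; ring.
Qed.

End SumIdentity.

Lemma sumI2 (V : nmodType) (F : 'I_2 -> V) : \sum_i F i = F 0 + F 1.
Proof. by rewrite big_ord_recl big_ord1; congr (_ + F _); apply: val_inj. Qed.

Lemma I2P (i : 'I_2) : i = 0 \/ i = 1.
Proof. by case: i => [[|[|//]] lti]; [left|right]; apply: val_inj. Qed.

(** * Covectors on lists of sites, and the exchange of adjacent sites *)

Section ListModel.

Variables (C : fieldType) (Lambda : Type) (am bp bm cp cm : Lambda -> Lambda -> C).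

(** Entry in row [(a, s)] and column [(b, t)]: states [b] and [t] enter, [a] and [s] leave. *)
Definition weight (Rm : Lambda -> Lambda -> 'M[C]_(2 * 2)) (x y : Lambda)
    (a s b t : 'I_2) : C :=
  Rm x y (mxtens_index (a, s)) (mxtens_index (b, t)).

Notation r := (weight (Rmat am bp bm cp cm)).

Lemma weightE x y a s :
 (r x y a s 0 0 = ((a == 0) && (s == 0))%:R) *
 (r x y a s 0 1 = if s == 1 then (a == 0)%:R * bp x y else (a == 1)%:R * cm x y) *
 (r x y a s 1 0 = if s == 0 then (a == 1)%:R * bm x y else (a == 0)%:R * cp x y) *
 (r x y a s 1 1 = ((a == 1) && (s == 1))%:R * am x y).
Proof.
by case: (I2P a) => ->; case: (I2P s) => ->;
  rewrite /weight !mxE /= ?mul1r ?mul0r.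
Qed.


(* The covector g on V_a and the sites multiplied on the right by the          *)
(* monodromy R_{a n} ... R_{a 1}, at auxiliary state b and site states l; the  *)
(* head of xs is site 1. Junk when xs and l have different sizes.              *)
Fixpoint row_transfer (nu : Lambda) (xs : seq Lambda)
    (g : 'I_2 -> seq 'I_2 -> C) (b : 'I_2) (l : seq 'I_2) : C :=
  match xs, l with
  | x :: xs', t :: l' =>
    \sum_c \sum_s r nu x c s b t * row_transfer nu xs' (fun a l => g a (s :: l)) c l'
  | _, _ => g b l
  end.

Lemma row_transfer_ext nu xs g g' b l :
  (forall a l', size l' = size l -> g a l' = g' a l') ->
  row_transfer nu xs g b l = row_transfer nu xs g' b l.
Proof.
elim: xs g g' b l => [|x xs IHxs] g g' b [|t l] gg' /=; try exact: gg'.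
apply: eq_bigr => c _; apply: eq_bigr => s _; congr (_ * _).
by apply: IHxs => a l' sl'; apply: gg'; rewrite /= sl'.
Qed.

Lemma row_transfer_sum nu xs (J : finType) (k : J -> C) g b l :
  row_transfer nu xs (fun a l' => \sum_j k j * g j a l') b l =
  \sum_j k j * row_transfer nu xs (g j) b l.
Proof.
elim: xs g b l => [|x xs IHxs] g b [|t l] //=.
under eq_bigr => c _ do under eq_bigr => s _ do rewrite IHxs mulr_sumr.
under eq_bigr => c _ do rewrite exchange_big /=.
rewrite exchange_big /=; apply: eq_bigr => j _; rewrite mulr_sumr.
apply: eq_bigr => c _; rewrite mulr_sumr; apply: eq_bigr => s _.
by rewrite mulrCA.
Qed.

Lemma row_transferZ nu xs k g b l :
  row_transfer nu xs (fun a l' => k * g a l') b l = k * row_transfer nu xs g b l.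
Proof.
elim: xs g b l => [|x xs IHxs] g b [|t l] //=.
under eq_bigr => c _ do under eq_bigr => s _ do rewrite IHxs mulrCA.
by rewrite mulr_sumr; apply: eq_bigr => c _; rewrite mulr_sumr.
Qed.

Lemma row_transfer_rcons nu xs x g b l t : size l = size xs ->
  row_transfer nu (rcons xs x) g b (rcons l t) =
  row_transfer nu xs
    (fun a l' => \sum_c \sum_s r nu x c s a t * g c (rcons l' s)) b l.
Proof.
elim: xs g b l => [|y xs IHxs] g b [|u l] //= [] sl.
by apply: eq_bigr => c _; apply: eq_bigr => s _; rewrite IHxs.
Qed.

(* R12 R13 R23 = R23 R13 R12 with spaces (1, 2, 3) = (a, y, x), multiplied on  *)
(* the left by an arbitrary covector f.                                        *)
Definition ybe_rows (n y x : Lambda) := forall f b t s,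
  \sum_t' \sum_s' r y x t' s' t s * (\sum_c \sum_s0 r n x c s0 b s' *
     (\sum_d \sum_t0 r n y d t0 c t' * f d t0 s0))
  = \sum_c \sum_t' r n y c t' b t * (\sum_d \sum_s' r n x d s' c s *
     (\sum_t0 \sum_s0 r y x t0 s0 t' s' * f d t0 s0)).

(** R passes through one row by Yang-Baxter. The covector [g'] is what [g] becomes once R acts on
    it, so the lemma can be iterated over rows. *)
Lemma row_transfer_exchange nu x y u v g g' b l1 l2 t s :
  ybe_rows nu y x -> size l1 = size u ->
  (forall a m1 m2 t s, size m1 = size u ->
    \sum_t' \sum_s' r y x t' s' t s * g a (m1 ++ s' :: t' :: m2) =
    g' a (m1 ++ t :: s :: m2)) ->
  \sum_t' \sum_s' r y x t' s' t s *
     row_transfer nu (u ++ x :: y :: v) g b (l1 ++ s' :: t' :: l2) =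
  row_transfer nu (u ++ y :: x :: v) g' b (l1 ++ t :: s :: l2).
Proof.
move=> ybe; elim: u l1 g g' b => [|z u IHu] [|w l1] g g' b //= => [_|[sl]] gg'.
  rewrite (ybe (fun d t0 s0 =>
    row_transfer nu v (fun a l => g a [:: s0, t0 & l]) d l2)).
  apply: eq_bigr => c _; apply: eq_bigr => t' _; congr (_ * _).
  apply: eq_bigr => d _; apply: eq_bigr => s' _; congr (_ * _).
  rewrite -(@row_transfer_ext nu v (fun a l => \sum_t0 \sum_s0
      r y x t0 s0 t' s' * g a [:: s0, t0 & l])); last first.
    by move=> a l' _; rewrite (gg' a [::]).
  rewrite pair_big /= -(row_transfer_sum _ _ (fun i => r y x i.1 i.2 t' s')
     (fun i a l => g a [:: i.2, i.1 & l])).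
  by apply: row_transfer_ext => a l' _; rewrite pair_big.
transitivity (\sum_c \sum_s0 r nu z c s0 b w *
  \sum_t' \sum_s' r y x t' s' t s * 
    row_transfer nu (u ++ [:: x, y & v]) (fun a l => g a (s0 :: l)) c
       (l1 ++ [:: s', t' & l2])).
  rewrite pair_big /=; under eq_bigr => i _ do rewrite pair_big mulr_sumr.
  rewrite exchange_big [RHS]pair_big /=; apply: eq_bigr => j _.
  rewrite pair_big mulr_sumr /=; apply: eq_bigr => i _; exact: mulrCA.
apply: eq_bigr => c _; apply: eq_bigr => s0 _; congr (_ * _).
apply: IHu => // a m1 m2 t' s' sm.
by rewrite (gg' a (s0 :: m1)) //= sm.
Qed.

(* <0| C(nu_m) ... C(nu_1) for nus = [:: nu_1; ...; nu_m].                     *)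
Fixpoint bra_C (nus : seq Lambda) (xs : seq Lambda) (l : seq 'I_2) : C :=
  if nus is nu :: nus' then
    row_transfer nu xs (fun a l' => (a == 1)%:R * bra_C nus' xs l') 0 l
  else (all (pred1 0) l)%:R.

(** R is carried through the rows one at a time; at the end <0| absorbs it, since R has the entry 1
    at e_1 (x) e_1 and zeros elsewhere in that row. *)
Lemma bra_C_exchange nus x y u v l1 l2 t s :
  (forall n, ybe_rows n y x) -> size l1 = size u ->
  \sum_t' \sum_s' r y x t' s' t s *
     bra_C nus (u ++ x :: y :: v) (l1 ++ s' :: t' :: l2) =
  bra_C nus (u ++ y :: x :: v) (l1 ++ t :: s :: l2).
Proof.
move=> ybe; elim: nus l1 l2 t s => [|nu nus IHn] l1 l2 t s sl /=.
  rewrite !sumI2 !all_cat /=.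
  case: (I2P t) => ->; case: (I2P s) => ->;
    by rewrite !weightE /=; case: (all _ l1); case: (all _ l2); rewrite /=; ring.
apply: row_transfer_exchange => // a m1 m2 t' s' sm.
rewrite -IHn // mulr_sumr; apply: eq_bigr => t0 _; rewrite mulr_sumr.
by apply: eq_bigr => s0 _; rewrite mulrCA.
Qed.

(** The last site is the leftmost factor of the monodromy, so the auxiliary state leaves it as e_2;
    with e_1 entering on the site, only [bm] allows this, and the site stays in e_1. *)
Lemma bra_C_rcons0 nus xs x l : size l = size xs ->
  bra_C nus (rcons xs x) (rcons l 0) =
  \prod_(nu <- nus) bm nu x * bra_C nus xs l.
Proof.
elim: nus l => [|nu nus IHn] l sl /=.
  by rewrite all_rcons /= big_nil mul1r.
rewrite row_transfer_rcons // big_cons -row_transferZ.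
apply: row_transfer_ext => a l' sl'.
rewrite !sumI2 !IHn ?sl' //.
by case: (I2P a) => ->; rewrite !weightE /=; ring.
Qed.

Definition ones (xs : seq Lambda) : seq 'I_2 := nseq (size xs) 1.

(* The component of bra_C with site x in state e_1 and all others in e_2.      *)
Definition bra_C0 nus (u : seq Lambda) (x : Lambda) v : C :=
  bra_C nus (u ++ x :: v) (ones u ++ 0 :: ones v).

Lemma ones_cat u v : ones (u ++ v) = ones u ++ ones v.
Proof. by rewrite /ones size_cat nseqD. Qed.

Lemma size_ones u : size (ones u) = size u.
Proof. exact: size_nseq. Qed.

Lemma bra_C0_nil nus u x :
  bra_C0 nus u x [::] = \prod_(nu <- nus) bm nu x * bra_C nus u (ones u).
Proof. by rewrite /bra_C0 !cats1 bra_C_rcons0 // size_ones. Qed.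

(** * Moving sites when a single one is in state e_1 *)

Section Exchange.

Hypothesis ybe : forall n y x, ybe_rows n y x.

Lemma bra_C0_move nus u x y v :
  bm y x * bra_C0 nus u x (y :: v) + cp y x * bra_C0 nus (rcons u x) y v =
  bra_C0 nus (rcons u y) x v.
Proof.
rewrite /bra_C0 -!cats1 -!catA !ones_cat -!catA /=.
rewrite -(@bra_C_exchange nus x y) ?size_ones //.
by rewrite !sumI2 !weightE /=; ring.
Qed.

(** e_2 (x) e_2 is an eigenvector of R with eigenvalue [am]. *)
Lemma bra_C0_swap nus u x y w z v :
  bra_C0 nus (u ++ y :: x :: w) z v = am y x * bra_C0 nus (u ++ x :: y :: w) z v.
Proof.
rewrite /bra_C0 -!catA !ones_cat -!catA /=.
rewrite -(@bra_C_exchange nus x y) ?size_ones //.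
by rewrite !sumI2 !weightE /=; ring.
Qed.

Lemma bra_C0_rot nus u x w z v :
  bra_C0 nus (u ++ rcons w x) z v =
  \prod_(y <- w) am y x * bra_C0 nus (u ++ x :: w) z v.
Proof.
elim: w u => [|y w IHw] u; first by rewrite big_nil mul1r.
rewrite /= -cat_rcons IHw cat_rcons bra_C0_swap big_cons; ring.
Qed.

End Exchange.

(** * Expansion of one row over the flipped site *)

Lemma row_transfer_ones1 nu xs g :
  row_transfer nu xs g 1 (ones xs) = \prod_(x <- xs) am nu x * g 1 (ones xs).
Proof.
elim: xs g => [|x xs IHxs] g /=; first by rewrite big_nil mul1r.
rewrite -/(ones xs) !sumI2 !weightE /= !IHxs big_cons; ring.
Qed.

Section Indexed.

Variables (L : nat) (xi : 'I_L -> Lambda).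

Definition before (i j : 'I_L) := (i < j)%N.

Notation bef s i := [seq k <- s | before k i].
Notation aft s i := [seq k <- s | before i k].

Lemma before_neq (i j : 'I_L) : before i j -> i != j.
Proof. by rewrite /before ltn_neqAle => /andP[]. Qed.

Lemma before_asym (i j : 'I_L) : before i j -> before j i = false.
Proof. by rewrite /before; case: ltngtP. Qed.

Lemma before_irr (i : 'I_L) : before i i = false.
Proof. exact: ltnn. Qed.

(** On sites in e_2, an auxiliary e_1 either passes with [bp] or becomes e_2 with [cm]; after that
    it can only pass, with [am]. *)
Lemma row_transfer_ones0 nu (s : seq 'I_L) g : pairwise before s ->
  row_transfer nu (map xi s) g 0 (ones (map xi s)) =
  \prod_(k <- s) bp nu (xi k) * g 0 (ones (map xi s)) +
  \sum_(i <- s) \prod_(k <- s | before k i) bp nu (xi k) * cm nu (xi i) *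
    \prod_(k <- s | before i k) am nu (xi k) *
    g 1 (ones (map xi (bef s i)) ++ 0 :: ones (map xi (aft s i))).
Proof.
elim: s g => [|x s IHs] g /=; first by rewrite !big_nil mul1r addr0.
move=> /andP[xs ps]; rewrite -/(ones (map xi s)) !sumI2 !weightE /=.
rewrite (IHs (fun a l => g a (1 :: l))) // row_transfer_ones1 big_map.
rewrite !big_cons !before_irr -[ones (xi x :: _)]/(1 :: ones _).
have no : \prod_(k <- s | before k x) bp nu (xi k) = 1.
  rewrite big_seq_cond big1 // => k /andP[/(allP xs) xk kx].
  by rewrite (before_asym xk) in kx.
have -> : [seq k <- s | before k x] = [::].
  rewrite -(filter_pred0 s); apply: eq_in_filter => k /(allP xs).
  exact: before_asym.
have -> : [seq k <- s | before x k] = s.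
  by rewrite -[RHS]filter_predT; apply: eq_in_filter => k /(allP xs).
have -> : \prod_(k <- s | before x k) am nu (xi k) = \prod_(k <- s) am nu (xi k).
  rewrite big_seq_cond [RHS]big_seq; apply: eq_bigl => k.
  by rewrite andb_idr // => /(allP xs).
rewrite no /=.
have -> : \sum_(j <- s)
     \prod_(k <- x :: s | before k j) bp nu (xi k) * cm nu (xi j) *
     \prod_(k <- x :: s | before j k) am nu (xi k) *
     g 1 (ones [seq xi i | i <- if before x j then x :: bef s j else bef s j] ++
        0 :: ones [seq xi i | i <- if before j x then x :: aft s j else aft s j])
  = bp nu (xi x) * \sum_(i <- s)
    \prod_(k <- s | before k i) bp nu (xi k) * cm nu (xi i) *
    \prod_(k <- s | before i k) am nu (xi k) *
    g 1 (1 :: ones (map xi (bef s i)) ++ 0 :: ones (map xi (aft s i))).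
  rewrite mulr_sumr big_seq [RHS]big_seq; apply: eq_bigr => j /(allP xs) xj.
  by rewrite !big_cons xj (before_asym xj) /= !mulrA.
ring.
Qed.

(** The factors with j = 1 in the permutation sum when sigma_1 = [i], apart from the [bm] of the
    later rows. *)
Definition site_coef nu (s : seq 'I_L) (i : 'I_L) : C :=
  cm nu (xi i) * \prod_(k <- s | k != i)
    (am nu (xi k) * theta am xi k i / bm (xi k) (xi i)).

Definition bra_C1 nus (u : seq 'I_L) (i : 'I_L) (v : seq 'I_L) : C :=
  bra_C0 nus (map xi u) (xi i) (map xi v).

Definition unit_rows (x y : Lambda) := forall f a b,
  \sum_t \sum_s r y x t s b a * (\sum_c \sum_d r x y c d s t * f c d) = f a b.

Hypothesis ybe : forall n y x, ybe_rows n y x.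
Hypothesis uni : forall x y, unit_rows x y.
Hypothesis bm_neq0 : forall i j : 'I_L, i != j -> bm (xi i) (xi j) != 0.

(** * Relations between the weights *)

Lemma am_inv x y : am x y * am y x = 1.
Proof.
have := uni x y (fun c d => ((c == 1) && (d == 1))%:R) 1 1.
rewrite !sumI2 !weightE /= => E; apply: (etrans _ E); ring.
Qed.

Lemma am_neq0 x y : am x y != 0.
Proof.
by apply/eqP => a0; have /eqP := am_inv x y; rewrite a0 mul0r eq_sym oner_eq0.
Qed.

Lemma cm_bm_unit x y : cm x y * bm y x + bm x y * cp y x = 0.
Proof.
have := uni x y (fun c d => ((c == 1) && (d == 0))%:R) 0 1.
rewrite !sumI2 !weightE /= => E; apply: (etrans _ E); ring.
Qed.

Lemma cm_swap x y : bm y x != 0 -> cm x y = - (bm x y * cp y x) / bm y x.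
Proof.
move=> nyx; apply: (mulIf nyx); rewrite mulfVK //; apply/eqP.
by rewrite -addr_eq0 cm_bm_unit.
Qed.

(** Component of Yang-Baxter with row e_2 e_2 e_1 and column e_1 e_2 e_2. *)
Lemma ybe_am_cm n x w :
  cm n w * bp n x * bm x w + cm n x * am n w * cm x w = cm n w * am n x * am x w.
Proof.
have := ybe n x w (fun a b c => ((a == 1) && (b == 1) && (c == 0))%:R) 0 1 1.
rewrite !sumI2 !weightE /= => E.
apply/eqP; rewrite -subr_eq0; move/eqP: E; rewrite -subr_eq0 -oppr_eq0.
by move/eqP => E; apply/eqP; rewrite -E; ring.
Qed.

(** Component of Yang-Baxter with row e_2 e_2 e_1 and column e_2 e_1 e_2. *)
Lemma ybe_am_bm x y z :
  am x y * bm x z * cm y z = bm x y * am x z * cm y z + cp x y * cm x z * bm y z.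
Proof.
have := ybe x y z (fun a b c => ((a == 1) && (b == 1) && (c == 0))%:R) 1 0 1.
rewrite !sumI2 !weightE /= => E.
apply/eqP; rewrite -subr_eq0; move/eqP: E; rewrite -subr_eq0.
by move/eqP => E; apply/eqP; rewrite -E; ring.
Qed.

(** After division by the weights [am nu _] this is [partial_fractions], its two-site relations
    being [ybe_am_bm] and [ybe_am_cm]. *)
Lemma flip_coef_identity nu (s : seq 'I_L) z : uniq (z :: s) ->
  cm nu (xi z) * \prod_(k <- s) bp nu (xi k) =
  cm nu (xi z) * \prod_(k <- s) (am nu (xi k) * am (xi k) (xi z) / bm (xi k) (xi z))
  - am nu (xi z) * \sum_(i <- s) cm nu (xi i) * (cm (xi i) (xi z) / bm (xi i) (xi z)) *
      \prod_(k <- s | k != i) (am nu (xi k) * am (xi k) (xi i) / bm (xi k) (xi i)).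
Proof.
move=> us; pose A := \prod_(k <- s) am nu (xi k).
pose f x w := am (xi x) (xi w) / bm (xi x) (xi w).
pose p x w := cm (xi x) (xi w) / bm (xi x) (xi w).
have fp x y w : x != y -> w != y -> x != w ->
    p y w * f x y = p y w * f x w - p y x * p x w.
  rewrite /f /p => xy wy xw.
  have nxy := bm_neq0 xy; have nyw : bm (xi y) (xi w) != 0.
    by apply: bm_neq0; rewrite eq_sym.
  have nyx : bm (xi y) (xi x) != 0 by apply: bm_neq0; rewrite eq_sym.
  have nxw := bm_neq0 xw.
  have E := ybe_am_bm (xi x) (xi y) (xi w).
  (* Unitarity turns [cp x y / bm x y] into [- cm y x / bm y x], which closes the relation on [f]
     and [p] alone. *)
  rewrite (cm_swap nxy).
  transitivity (am (xi x) (xi y) * bm (xi x) (xi w) * cm (xi y) (xi w)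
      / (bm (xi y) (xi w) * bm (xi x) (xi y) * bm (xi x) (xi w))).
    by field; rewrite ?nyw ?nxy ?nxw.
  by rewrite E; field; rewrite ?nxy ?nyw ?nxw ?nyx.
pose q i := cm nu (xi i) / am nu (xi i).
pose h k := bp nu (xi k) / am nu (xi k).
have qh : {in z :: s &, forall x w, x != w ->
    q w * h x = q w * f x w - q x * p x w}.
  rewrite /q /h /f /p => x w _ _ xw.
  have nxw := bm_neq0 xw; have E := ybe_am_cm nu (xi x) (xi w).
  have nx := am_neq0 nu (xi x); have nw := am_neq0 nu (xi w).
  apply/eqP; rewrite eq_sym subr_eq; apply/eqP.
  transitivity (cm nu (xi w) * am nu (xi x) * am (xi x) (xi w) /
    (am nu (xi w) * am nu (xi x) * bm (xi x) (xi w))).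
    by field; rewrite ?nx ?nw ?nxw.
  by rewrite -E; field; rewrite ?nx ?nw ?nxw.
have := partial_fractions fp us qh; rewrite /q /h /f /p {fp qh}.
move=> PF.
have An0 : A != 0.
  by rewrite /A prodf_seq_neq0; apply/allP => k _; exact: am_neq0.
have nz := am_neq0 nu (xi z).
have spl (F : 'I_L -> C) : \prod_(k <- s) (F k / am nu (xi k)) = \prod_(k <- s) F k / A.
  exact: prodf_div.
rewrite spl in PF.
have -> : cm nu (xi z) * \prod_(k <- s) bp nu (xi k) =
   am nu (xi z) * A * (cm nu (xi z) / am nu (xi z) * (\prod_(k <- s) bp nu (xi k) / A)).
  by field; rewrite An0 nz.
rewrite PF mulrBr; congr (_ - _).
  have -> : \prod_(k <- s) (am nu (xi k) * am (xi k) (xi z) / bm (xi k) (xi z)) =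
     A * \prod_(k <- s) (am (xi k) (xi z) / bm (xi k) (xi z)).
    by rewrite /A -big_split; apply: eq_bigr => k _ /=; rewrite mulrA.
  by field; rewrite nz.
rewrite -mulrA; congr (_ * _); rewrite mulr_sumr big_seq [RHS]big_seq.
apply: eq_bigr => i is_; have /andP[_ us'] := us.
have ni := am_neq0 nu (xi i).
have -> : \prod_(k <- s | k != i) (am nu (xi k) * am (xi k) (xi i) / bm (xi k) (xi i)) =
  \prod_(k <- s | k != i) am nu (xi k) *
  \prod_(k <- s | k != i) (am (xi k) (xi i) / bm (xi k) (xi i)).
  by rewrite -big_split; apply: eq_bigr => k _ /=; rewrite mulrA.
rewrite /A (bigD1_seq i) //=.
set P1 := \prod_(k <- s | _) _; set P2 := \prod_(k <- s | _) _.
set c := cm (xi i) (xi z) / _.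
by field; rewrite ni.
Qed.


(** * Moving the flipped site to the end, and the recursion *)

Lemma all_before_notin (s : seq 'I_L) y : all (before^~ y) s -> y \notin s.
Proof.
by move=> sy; apply/negP => /(allP sy); rewrite before_irr.
Qed.

Lemma pairwise_before_uniq (s : seq 'I_L) : pairwise before s -> uniq s.
Proof.
elim: s => //= x s IHs /andP[xs /IHs ->]; rewrite andbT.
by apply/negP => /(allP xs); rewrite before_irr.
Qed.

Lemma bra_C1_rot nus (s : seq 'I_L) i y v : pairwise before s -> i \in s ->
  bra_C1 nus (rcons [seq k <- s | k != i] i) y v =
  \prod_(k <- s | before i k) am (xi k) (xi i) * bra_C1 nus s y v.
Proof.
move=> ps /splitPr is_; case: s / is_ ps => u w.
rewrite pairwise_cat /= => /and4P[/allrelP ui _ iw _].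
have neu k : k \in u -> before k i by move=> ku; rewrite ui ?mem_head.
rewrite filter_cat /= eqxx /=.
have -> : [seq k <- u | k != i] = u.
  rewrite -[RHS]filter_predT; apply: eq_in_filter => k /neu; exact: before_neq.
have -> : [seq k <- w | k != i] = w.
  rewrite -[RHS]filter_predT; apply: eq_in_filter => k /(allP iw)/before_neq.
  by rewrite eq_sym.
rewrite big_cat big_cons before_irr /= big_seq_cond big1 ?mul1r; last first.
  by move=> k /andP[/neu/before_asym->].
rewrite /bra_C1 rcons_cat !map_cat map_rcons /= bra_C0_rot // big_map.
congr (_ * _); rewrite big_seq [RHS]big_seq_cond; apply: eq_bigl => k.
by rewrite andb_idr // => /(allP iw).
Qed.

Lemma site_coef_rcons nu (s : seq 'I_L) y i :
  all (before^~ y) s -> i \in s ->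
  site_coef nu (rcons s y) i =
  site_coef nu s i * (am nu (xi y) / bm (xi y) (xi i)).
Proof.
move=> sy is_; have iy := allP sy _ is_.
rewrite /site_coef -cats1 big_cat big_cons big_nil /= eq_sym before_neq //.
by rewrite /theta -/(before y i) before_asym //= !mulr1 !mulrA.
Qed.

Lemma site_coef_last nu (s : seq 'I_L) y : all (before^~ y) s ->
  site_coef nu (rcons s y) y = cm nu (xi y) *
    \prod_(k <- s) (am nu (xi k) * am (xi k) (xi y) / bm (xi k) (xi y)).
Proof.
move=> sy; rewrite /site_coef -cats1 big_cat big_cons big_nil eqxx /= mulr1.
congr (_ * _); rewrite big_seq_cond [RHS]big_seq.
apply: eq_big => k; first by rewrite andb_idr // => /(allP sy)/before_neq.
by case/andP=> /(allP sy); rewrite /before /theta => ->.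
Qed.

(** [theta] supplies [am] for the sites before [i] and the extra product for those after it, so the
    result no longer depends on the order. *)
Lemma site_coef_theta nu (s : seq 'I_L) i :
  site_coef nu s i * \prod_(k <- s | before i k) am (xi k) (xi i) =
  cm nu (xi i) * \prod_(k <- s | k != i)
    (am nu (xi k) * am (xi k) (xi i) / bm (xi k) (xi i)).
Proof.
rewrite /site_coef -mulrA; congr (_ * _).
have -> : \prod_(k <- s | before i k) am (xi k) (xi i) =
   \prod_(k <- s | k != i) (if before i k then am (xi k) (xi i) else 1).
  rewrite -big_mkcondr /=; apply: eq_bigl => k.
  by rewrite andb_idl // => /before_neq; rewrite eq_sym.
rewrite -big_split; apply: eq_bigr => k /= ki.
rewrite /theta /before; case: ltngtP => [_|_|/val_inj e].
- by rewrite mulr1.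
- by rewrite mulr1 mulrAC.
- by rewrite e eqxx in ki.
Qed.

(** Induction on the last site [y] of [s]. The sites [v] to the right are spectators, kept general
    because the induction hypothesis is used with [y :: v]. *)
Lemma flip_sum nu nus (s v : seq 'I_L) : pairwise before s ->
  \sum_(i <- s) \prod_(k <- s | before k i) bp nu (xi k) * cm nu (xi i) *
    \prod_(k <- s | before i k) am nu (xi k) *
    bra_C1 nus (bef s i) i (aft s i ++ v) =
  \sum_(i <- s) site_coef nu s i * bra_C1 nus [seq k <- s | k != i] i v.
Proof.
elim/last_ind: s v => [|s y IHs] v; first by rewrite !big_nil.
rewrite pairwise_rcons => /andP[sy ps].
have ys := all_before_notin sy.
have us : uniq (y :: s) by rewrite /= ys pairwise_before_uniq.
rewrite -cats1 !big_cat !big_cons !big_nil /= !addr0 cats1.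
set T := _ * bra_C1 _ _ y _.
have -> : T = cm nu (xi y) * \prod_(k <- s) bp nu (xi k) * bra_C1 nus s y v.
  rewrite /T !filter_rcons before_irr.
  have -> : bef s y = s.
    by rewrite -[RHS]filter_predT; apply: eq_in_filter => k /(allP sy).
  have -> : aft s y = [::].
    rewrite -(filter_pred0 s); apply: eq_in_filter => k /(allP sy).
    exact: before_asym.
  rewrite -cats1 !big_cat !big_cons !big_nil before_irr /= !mulr1.
  have -> : \prod_(k <- s | before y k) am nu (xi k) = 1.
    rewrite big_seq_cond big1 // => k /andP[/(allP sy) ky yk].
    by rewrite (before_asym ky) in yk.
  rewrite mulr1 mulrC [cm _ _ * _]mulrC mulrC; congr (_ * _ * _).
  rewrite big_seq_cond [RHS]big_seq; apply: eq_bigl => k.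
  by rewrite andb_idr // => /(allP sy).
have -> : \sum_(i <- s)
     \prod_(k <- rcons s y | before k i) bp nu (xi k) * cm nu (xi i) *
     \prod_(k <- rcons s y | before i k) am nu (xi k) *
     bra_C1 nus (bef (rcons s y) i) i (aft (rcons s y) i ++ v) =
   am nu (xi y) * \sum_(i <- s) site_coef nu s i *
      bra_C1 nus [seq k <- s | k != i] i (y :: v).
  rewrite -(IHs (y :: v) ps) mulr_sumr big_seq [RHS]big_seq.
  apply: eq_bigr => i is_; have iy := allP sy _ is_.
  rewrite !filter_rcons iy (before_asym iy) cat_rcons.
  rewrite -cats1 !big_cat !big_cons !big_nil iy (before_asym iy) /= !mulr1.
  ring.
rewrite filter_rcons eqxx.
have -> : [seq k <- s | k != y] = s.
  rewrite -[RHS]filter_predT; apply: eq_in_filter => k /(allP sy).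
  exact: before_neq.
rewrite (flip_coef_identity nu us) site_coef_last //.
have -> : \sum_(i <- s) site_coef nu (rcons s y) i *
     bra_C1 nus [seq k <- rcons s y | k != i] i v =
   am nu (xi y) * \sum_(i <- s) site_coef nu s i *
      bra_C1 nus [seq k <- s | k != i] i (y :: v)
   - am nu (xi y) * (\sum_(i <- s) cm nu (xi i) *
        (cm (xi i) (xi y) / bm (xi i) (xi y)) *
        \prod_(k <- s | k != i)
          (am nu (xi k) * am (xi k) (xi i) / bm (xi k) (xi i)))
     * bra_C1 nus s y v; last by ring.
rewrite -mulrA -mulrBr mulr_suml -sumrB mulr_sumr big_seq [RHS]big_seq.
apply: eq_bigr => i is_; have iy := allP sy _ is_.
rewrite site_coef_rcons // filter_rcons eq_sym before_neq //.
have byi : bm (xi y) (xi i) != 0 by apply: bm_neq0; rewrite eq_sym before_neq.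
have biy : bm (xi i) (xi y) != 0 by apply/bm_neq0/before_neq.
(* Moving [i] past [y] leaves a term with [y] in e_1; there [i] is in e_2 and returns to its place
   in [s] by [bra_C1_rot], so this term is a multiple of [bra_C1 nus s y v] for every [i]. *)
have := bra_C0_move ybe nus (map xi [seq k <- s | k != i]) (xi i) (xi y) (map xi v).
rewrite -!map_rcons -/(bra_C1 nus (rcons _ y) i v) -/(bra_C1 nus _ i (y :: v)).
rewrite -/(bra_C1 nus (rcons _ i) y v) bra_C1_rot // => <-.
rewrite [cm nu (xi i) * _ * _]mulrAC -site_coef_theta.
rewrite (cm_swap byi).
by field; rewrite byi biy.
Qed.

Lemma bra_C_recursion nu nus (s : seq 'I_L) : pairwise before s ->
  bra_C (nu :: nus) (map xi s) (ones (map xi s)) =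
  \sum_(i <- s) site_coef nu s i *
    (\prod_(n <- nus) bm n (xi i) *
     bra_C nus (map xi [seq k <- s | k != i]) (ones (map xi [seq k <- s | k != i]))).
Proof.
(* The term without a flip vanishes: its auxiliary state leaves as e_1. *)
move=> ps; rewrite /= row_transfer_ones0 //= !mul0r mulr0 add0r.
transitivity (\sum_(i <- s) site_coef nu s i *
    bra_C1 nus [seq k <- s | k != i] i [::]); last first.
  by apply: eq_bigr => i _; rewrite /bra_C1 bra_C0_nil.
rewrite -flip_sum // big_seq [RHS]big_seq; apply: eq_bigr => i is_.
rewrite mul1r cats0 /bra_C1 /bra_C0 -/(map xi (i :: _)) -map_cat.
suff -> : bef s i ++ i :: aft s i = s by [].
case/splitPr: s / is_ ps => u w.
rewrite pairwise_cat /= => /and4P[/allrelP ui _ iw _].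
have neu k : k \in u -> before k i by move=> ku; rewrite ui ?mem_head.
rewrite !filter_cat /= before_irr.
have -> : bef u i = u.
  by rewrite -[RHS]filter_predT; apply: eq_in_filter => k /neu.
have -> : aft w i = w.
  by rewrite -[RHS]filter_predT; apply: eq_in_filter => k /(allP iw).
have -> : bef w i = [::].
  rewrite -(filter_pred0 w); apply: eq_in_filter => k /(allP iw).
  exact: before_asym.
have -> : aft u i = [::].
  by rewrite -(filter_pred0 u); apply: eq_in_filter => k /neu/before_asym.
by rewrite cats0.
Qed.

End Indexed.

End ListModel.

(** * From matrices on configurations to the list model *)

Section MatrixLink.

Variables (C : fieldType).

Definition row_fun (I : finType) (v : 'rV[C]_#|{: cfg I}|) (s : cfg I) : C :=
  v 0 (enum_rank s).

Lemma row_fun_mul (I : finType) (v : 'rV[C]_#|{: cfg I}|) (X : tensEnd C I) t :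
  row_fun (v *m X) t =
  \sum_(s : cfg I) row_fun v s * X (enum_rank s) (enum_rank t).
Proof.
rewrite /row_fun mxE (reindex (@enum_rank _)) //=.
exact/onW_bij/enum_rank_bij.
Qed.

Definition upd2 (I : finType) (i j : I) (t : cfg I) (a b : 'I_2) : cfg I :=
  [ffun k => if k == i then a else if k == j then b else t k].

Lemma row_fun_act2 (I : finType) (i j : I) X (v : 'rV[C]_#|{: cfg I}|) t :
  i != j ->
  row_fun (v *m act2 i j X) t =
  \sum_a \sum_b X (mxtens_index (a, b)) (mxtens_index (t i, t j)) *
     row_fun v (upd2 i j t a b).
Proof.
rewrite eq_sym => /negPf ji; rewrite row_fun_mul pair_big /=.
transitivity (\sum_(s : cfg I | [forall k, (k != i) ==> (k != j) ==> (s k == t k)])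
   X (mxtens_index (s i, s j)) (mxtens_index (t i, t j)) * row_fun v s).
  rewrite [RHS]big_mkcond; apply: eq_bigr => s _; rewrite mxE /= !enum_rankK.
  by case: [forall _, _]; rewrite ?mulr1 ?mulr0 // mulrC.
rewrite (reindex_onto (fun ab => upd2 i j t ab.1 ab.2) (fun s => (s i, s j))) /=.
  apply: eq_big => [[a b]|[a b] _] /=.
    rewrite !ffunE !eqxx ji eqxx andbT.
    apply/forallP => k; rewrite ffunE.
    by case: (k == i); case: (k == j) => //=.
  by rewrite !ffunE !eqxx ji.
move=> s /forallP st; apply/ffunP => k; rewrite ffunE /=.
have := st k; case: eqP => [->//|_]; case: eqP => [->//|_] /=.
by move/eqP.
Qed.

Lemma row_of_fun (I : finType) (F : cfg I -> C) :
  exists v : 'rV[C]_#|{: cfg I}|, row_fun v =1 F.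
Proof.
exists (\row_p F (enum_val p)) => s; by rewrite /row_fun mxE enum_rankK.
Qed.

Variables (Lambda : Type) (am bp bm cp cm : Lambda -> Lambda -> C).
Notation Rm := (Rmat am bp bm cp cm).

Lemma unitarity_rows : unitarity Rm -> forall x y, unit_rows am bp bm cp cm x y.
Proof.
move=> uni x y f a b.
have [v vE] := row_of_fun (fun s : cfg 'I_2 => f (s 0) (s 1)).
pose t : cfg 'I_2 := [ffun k => if k == 0 then a else b].
have := congr1 (fun X => row_fun (v *m X) t) (uni x y).
rewrite mulmx1 mulmxA vE row_fun_act2 // !ffunE /= => <-.
rewrite exchange_big exchange_big.
apply: eq_bigr => t' _; apply: eq_bigr => s' _; congr (_ * _).
rewrite row_fun_act2 // !ffunE /=.
apply: eq_bigr => c _; apply: eq_bigr => d _; congr (_ * _).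
by rewrite vE !ffunE.
Qed.

Lemma yang_baxter_rows :
  yang_baxter Rm -> forall n y x, ybe_rows am bp bm cp cm n y x.
Proof.
move=> yb n y x f b t s.
have [v vE] := row_of_fun (fun u : cfg 'I_3 => f (u 0) (u 1) (u 2)).
pose w : cfg 'I_3 := [ffun k => if k == 0 then b else if k == 1 then t else s].
have := congr1 (fun X => row_fun (v *m X) w) (yb n y x).
rewrite !mulmxA /=.
rewrite row_fun_act2 // !ffunE /= => E; apply: etrans (etrans E _).
  apply: eq_bigr => t' _; apply: eq_bigr => s' _; congr (_ * _).
  rewrite row_fun_act2 // !ffunE /=.
  apply: eq_bigr => c _; apply: eq_bigr => s0 _; congr (_ * _).
  rewrite row_fun_act2 // !ffunE /=.
  apply: eq_bigr => d _; apply: eq_bigr => t0 _; congr (_ * _).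
  by rewrite vE !ffunE.
rewrite row_fun_act2 // !ffunE /=.
apply: eq_bigr => t' _; apply: eq_bigr => s' _; congr (_ * _).
rewrite row_fun_act2 // !ffunE /=.
apply: eq_bigr => c _; apply: eq_bigr => s0 _; congr (_ * _).
rewrite row_fun_act2 // !ffunE /=.
apply: eq_bigr => d _; apply: eq_bigr => t0 _; congr (_ * _).
by rewrite vE !ffunE.
Qed.

Definition cfg_seq (n : nat) (t : cfg 'I_n) : seq 'I_2 := map t (enum 'I_n).

Lemma map_inord_iota (T : Type) (m : nat) (f : 'I_m.+1 -> T) :
  map f (enum 'I_m.+1) = map (f \o inord) (iota 0 m.+1).
Proof.
by rewrite -val_enum_ord -map_comp; apply: eq_map => i /=; rewrite inord_val.
Qed.

Lemma prod_rev_inord (V : pzSemiRingType) (m : nat) (F : 'I_m.+1 -> V) :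
  \prod_(k < m.+1) F (rev_ord k) = \prod_(0 <= k < m.+1) F (inord (m - k)).
Proof.
rewrite big_mkord; apply: eq_bigr => k _; congr F; apply: val_inj.
by rewrite /= inordK ?subSS // ltnS leq_subr.
Qed.

Lemma row_fun_monodromy (L m : nat) (xi : 'I_L -> Lambda)
    (l : 'I_m.+1 -> 'I_L) nu (v : 'rV[C]_#|{: cfg (option 'I_m.+1)}|) g c :
  (forall c', row_fun v c' =
     g (c' None) (cfg_seq [ffun j => c' (Some j)])) ->
  row_fun (v *m monodromy Rm xi l nu) c =
  row_transfer am bp bm cp cm nu (map (xi \o l) (enum 'I_m.+1)) g (c None)
    (cfg_seq [ffun j => c (Some j)]).
Proof.
move=> vg.
pose st c (j : nat) : 'I_2 := (c : cfg (option 'I_m.+1)) (Some (inord j)).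
have seqE (c' : cfg (option 'I_m.+1)) :
    cfg_seq [ffun j => c' (Some j)] = map (st c') (iota 0 m.+1).
  by rewrite /cfg_seq map_inord_iota; apply: eq_map => j /=; rewrite ffunE.
pose F k := act2 None (Some k) (Rm nu (xi (l k))).
rewrite /monodromy (prod_rev_inord F) map_inord_iota seqE.
pose X := (xi \o l) \o (inord : nat -> 'I_m.+1).
(* The [n] leftmost factors act on the last [n] sites only; the states of the others are fixed
   inside the covector. *)
suff H n : (n <= m.+1)%N -> forall c,
    row_fun (v *m \prod_(0 <= k < n) F (inord (m - k))) c =
    row_transfer am bp bm cp cm nu (map X (iota (m.+1 - n) n))
      (fun a l' => g a (map (st c) (iota 0 (m.+1 - n)) ++ l')) (c None)
      (map (st c) (iota (m.+1 - n) n)).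
  by rewrite H // subnn.
elim: n => [_ c'|n IHn ltnm c'].
  by rewrite big_nil mulmx1 vg seqE subn0 /= cats0.
have le_nm : (n <= m)%N by [].
rewrite big_nat_recr //= -mulmxE mulmxA row_fun_act2 //.
set k := (m - n)%N; have ltkm : (k < m.+1)%N by rewrite ltnS leq_subr.
rewrite subSS -/k /=.
apply: eq_bigr => a _; apply: eq_bigr => s _; congr (_ * _).
rewrite (IHn (ltnW ltnm)) subSn // -/k ffunE eqxx.
have st_neq j : (j < m.+1)%N -> j != k ->
    st (upd2 None (Some (inord k)) c' a s) j = st c' j.
  move=> ltjm jk; rewrite /st ffunE /= ifN //; apply: contraNneq jk => - [].
  by move/(congr1 val); rewrite /= !inordK // => ->.
have -> : [seq st (upd2 None (Some (inord k)) c' a s) j | j <- iota k.+1 n] =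
    [seq st c' j | j <- iota k.+1 n].
  apply/eq_in_map => j; rewrite mem_iota => /andP[ltkj].
  rewrite addSn subnK // => ltjm.
  by rewrite st_neq // gtn_eqF.
apply: row_transfer_ext => b l' _; congr (g _ _).
rewrite -[k.+1]addn1 iotaD map_cat -catA; congr (_ ++ _).
  apply/eq_in_map => j; rewrite mem_iota add0n => /= ltjk.
  by rewrite st_neq ?(ltn_trans ltjk) // ltn_eqF.
by rewrite /= /st ffunE /= eqxx.
Qed.

Lemma row_fun_Cop (L m : nat) (xi : 'I_L -> Lambda)
    (l : 'I_m.+1 -> 'I_L) nu (v : 'rV[C]_#|{: cfg 'I_m.+1}|) f t :
  (forall t', row_fun v t' = f (cfg_seq t')) ->
  row_fun (v *m Cop Rm xi l nu) t =
  row_transfer am bp bm cp cm nu (map (xi \o l) (enum 'I_m.+1))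
    (fun a l' => (a == 1)%:R * f l') 0 (cfg_seq t).
Proof.
move=> vf.
(* Tensoring the covector with the dual of e_2 on V_a selects row 1 of the monodromy, hence its
   entry C at column 0. *)
have [w wE] := row_of_fun (fun c : cfg (option 'I_m.+1) =>
  (c None == 1)%:R * f (cfg_seq [ffun j => c (Some j)])).
have := row_fun_monodromy xi l nu (aux_cfg 0 t)
  (g := fun a l' => (a == 1)%:R * f l') wE.
rewrite ffunE /= (_ : [ffun j => _] = t); last first.
  by apply/ffunP => j; rewrite !ffunE.
move=> <-; rewrite !row_fun_mul.
rewrite [RHS](bigID (fun c : cfg (option 'I_m.+1) => c None == 1)) /=.
rewrite [X in _ = _ + X]big1 ?addr0; last first.
  by move=> c /negPf c1; rewrite wE c1 !mul0r.
rewrite (reindex_onto (aux_cfg 1) (fun c => [ffun j => c (Some j)])) /=; last first.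
  move=> c /eqP c1; apply/ffunP => -[j|]; rewrite !ffunE //=.
  by rewrite ffunE.
apply: eq_big => [s|s _].
  rewrite ffunE eqxx /=; apply/esym/eqP/ffunP => j; by rewrite !ffunE.
rewrite vf mxE !enum_rankK wE ffunE eqxx mul1r; congr (f (cfg_seq _) * _).
by apply/ffunP => j; rewrite !ffunE.
Qed.

Lemma row_fun_bra0 (n : nat) t : row_fun (bra0 C n) t = (all (pred1 0) (cfg_seq t))%:R.
Proof.
rewrite /row_fun !mxE enum_rankK.
rewrite -big_enum /cfg_seq /=; elim: (enum _) => [|i e IHe] /=.
  by rewrite big_nil.
by rewrite big_cons IHe mxE andbT; case: (t i == 0); rewrite ?mul1r ?mul0r.
Qed.

Lemma row_mul_ket1 (n : nat) (v : 'rV[C]_#|{: cfg 'I_n}|) :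
  (v *m ket1 C n) 0 0 = row_fun v [ffun => 1].
Proof.
rewrite mxE (reindex (@enum_rank _)) /=; last exact/onW_bij/enum_rank_bij.
rewrite (bigD1 [ffun => 1]) //= big1 ?addr0.
  by rewrite mxE enum_rankK big1 ?mulr1 // => i _; rewrite ffunE mxE.
move=> s s1; rewrite mxE enum_rankK.
have [i si] : exists i, s i != 1.
  apply/existsP; rewrite -negb_forall; apply: contra s1 => /forallP s1.
  by apply/eqP/ffunP => i; rewrite ffunE; apply/eqP.
by rewrite (bigD1 i) //= mxE (negPf si) /= mul0r mulr0.
Qed.

Lemma ZC_bra_C (L m : nat) (xi : 'I_L -> Lambda) (l : 'I_m.+1 -> 'I_L)
    (nu : 'I_m.+1 -> Lambda) :
  ZC Rm xi l nu = bra_C am bp bm cp cm (map nu (enum 'I_m.+1))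
    (map (xi \o l) (enum 'I_m.+1)) (ones (map (xi \o l) (enum 'I_m.+1))).
Proof.
have -> : ones (map (xi \o l) (enum 'I_m.+1)) =
    cfg_seq ([ffun => 1] : cfg 'I_m.+1).
  rewrite /ones size_map /cfg_seq.
  by elim: (enum _) => //= i s ->; rewrite ffunE.
rewrite /ZC row_mul_ket1 (prod_rev_inord (fun k => Cop Rm xi l (nu k))).
rewrite (map_inord_iota nu).
suff H n : (n <= m.+1)%N -> forall t,
    row_fun (bra0 C m.+1 *m \prod_(0 <= k < n) Cop Rm xi l (nu (inord (m - k)))) t =
    bra_C am bp bm cp cm (map (nu \o inord) (iota (m.+1 - n) n))
      (map (xi \o l) (enum 'I_m.+1)) (cfg_seq t).
  by rewrite H // subnn.
elim: n => [_ t|n IHn ltnm t].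
  by rewrite big_nil mulmx1 row_fun_bra0.
rewrite big_nat_recr //= -mulmxE mulmxA (row_fun_Cop _ _ _ _ (IHn (ltnW ltnm))).
by rewrite subSS subSn.
Qed.

End MatrixLink.

(** * From the recursion to the sum over permutations *)

Section PermutationSum.

Variables (C : fieldType) (Lambda : Type) (am bp bm cp cm : Lambda -> Lambda -> C).
Variables (L : nat) (xi : 'I_L -> Lambda).

Lemma sum_lift_perm (V : nmodType) (n : nat) (F : 'S_n.+1 -> V) :
  \sum_s F s = \sum_i \sum_(s : 'S_n) F (lift_perm ord0 i s).
Proof.
rewrite pair_big /= (reindex (fun p : 'I_n.+1 * 'S_n => lift_perm ord0 p.1 p.2)) //.
apply/onW_bij/inj_card_bij => [[i s] [j t] /= e|].
  have ij : i = j by rewrite -(lift_perm_id ord0 i s) e lift_perm_id.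
  congr (_, _) => //; apply/permP => k; apply: (@lift_inj _ i).
  by rewrite -(lift_perm_lift ord0) e ij lift_perm_lift.
by rewrite card_prod card_ord !card_Sn.
Qed.

Lemma pairwise_before_map (n : nat) (f : 'I_n -> 'I_L) :
  (forall i j : 'I_n, (i < j)%N -> (f i < f j)%N) ->
  pairwise (@before L) (map f (enum 'I_n)).
Proof.
move=> hf; rewrite pairwise_map.
have : pairwise ltn (map val (enum 'I_n)).
  by rewrite val_enum_ord -sorted_pairwise ?iota_ltn_sorted //; exact: ltn_trans.
by rewrite pairwise_map; apply: sub_pairwise => j k /hf.
Qed.

(** Both lists are strictly sorted and have the same members. *)
Lemma filter_neq_lift (n : nat) (l : 'I_n.+1 -> 'I_L) i :
  (forall i j : 'I_n.+1, (i < j)%N -> (l i < l j)%N) ->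
  [seq k <- map l (enum 'I_n.+1) | k != l i] = map (l \o lift i) (enum 'I_n).
Proof.
move=> hl.
have linj : injective l.
  move=> j k e; apply: val_inj; case: (ltngtP (val j) (val k)) => // /hl;
  by rewrite e ltnn.
have tr : transitive (@before L) by move=> ? ? ?; exact: ltn_trans.
apply: (irr_sorted_eq tr (@before_irr L)).
- by apply/pairwise_sorted/pairwise_filter/pairwise_before_map.
- apply/pairwise_sorted/pairwise_before_map => j k jk; apply: hl.
  by rewrite /= ltnNge leq_bump2 -ltnNge.
move=> k; rewrite mem_filter; apply/andP/mapP => [[ki /mapP[j _ e]]|[j _ ->]].
  rewrite e in ki *; case: (unliftP i j) ki => [j' ->|->]; last by rewrite eqxx.
  by exists j'; rewrite ?mem_enum.
by rewrite /= (inj_eq linj) eq_sym neq_lift /= map_f ?mem_enum.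
Qed.

Hypothesis ybe : forall n y x, ybe_rows am bp bm cp cm n y x.
Hypothesis uni : forall x y, unit_rows am bp bm cp cm x y.
Hypothesis bm_neq0 : forall i j : 'I_L, i != j -> bm (xi i) (xi j) != 0.

Lemma bra_C_permutations (n : nat) (l : 'I_n -> 'I_L) (nu : 'I_n -> Lambda) :
  (forall i j : 'I_n, (i < j)%N -> (l i < l j)%N) ->
  bra_C am bp bm cp cm (map nu (enum 'I_n)) (map xi (map l (enum 'I_n)))
    (ones (map xi (map l (enum 'I_n)))) =
  \sum_(s : 'S_n)
    (\prod_(i < n) cm (nu i) (xi (l (s i)))) *
    \prod_(j < n) \prod_(k < n | (j < k)%N)
      (bm (nu k) (xi (l (s j))) * am (nu j) (xi (l (s k)))
         * theta am xi (l (s k)) (l (s j))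
       / bm (xi (l (s k))) (xi (l (s j)))).
Proof.
elim: n l nu => [|n IHn] l nu hl.
  rewrite (big_pred1 1%g) => [|s]; last first.
    by apply/esym/eqP/permP => -[].
  by rewrite !big_ord0 mulr1 (size0nil (size_enum_ord 0)).
have pl : pairwise (@before L) (map l (enum 'I_n.+1)) by exact: pairwise_before_map.
rewrite [map nu _](_ : _ = nu ord0 :: map (nu \o lift ord0) (enum 'I_n)); last first.
  by rewrite enum_ordSl /= -map_comp.
rewrite bra_C_recursion // big_map big_enum /= sum_lift_perm.
apply: eq_bigr => i _; rewrite filter_neq_lift // IHn; last first.
  by move=> j k jk; apply: hl; rewrite /= ltnNge leq_bump2 -ltnNge.
rewrite !mulr_sumr; apply: eq_bigr => s _.
rewrite /site_coef -(big_filter _ (fun k => k != l i)) filter_neq_lift //.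
rewrite 2!big_map !big_enum /=.
have tail_prod (j : 'I_n) (F : 'I_n.+1 -> C) :
    \prod_(k < n.+1 | (lift ord0 j < k)%N) F k =
    \prod_(k < n | (j < k)%N) F (lift ord0 k).
  by rewrite big_mkcond big_ord_recl /= mul1r [RHS]big_mkcond.
have head_prod (F : 'I_n.+1 -> C) :
    \prod_(k < n.+1 | (0 < k)%N) F k = \prod_(k < n) F (lift ord0 k).
  by rewrite big_mkcond big_ord_recl /= mul1r.
rewrite ![in RHS]big_ord_recl head_prod lift_perm_id.
have -> : \prod_(k < n) cm (nu (lift ord0 k)) (xi (l (lift_perm ord0 i s (lift ord0 k)))) =
    \prod_(k < n) cm (nu (lift ord0 k)) (xi (l (lift i (s k)))).
  by apply: eq_bigr => k _; rewrite lift_perm_lift.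
have -> : \prod_(j < n) \prod_(k < n.+1 | (lift ord0 j < k)%N)
      (bm (nu k) (xi (l (lift_perm ord0 i s (lift ord0 j)))) *
       am (nu (lift ord0 j)) (xi (l (lift_perm ord0 i s k))) *
       theta am xi (l (lift_perm ord0 i s k)) (l (lift_perm ord0 i s (lift ord0 j))) /
       bm (xi (l (lift_perm ord0 i s k))) (xi (l (lift_perm ord0 i s (lift ord0 j))))) =
    \prod_(j < n) \prod_(k < n | (j < k)%N)
      (bm (nu (lift ord0 k)) (xi (l (lift i (s j)))) *
       am (nu (lift ord0 j)) (xi (l (lift i (s k)))) *
       theta am xi (l (lift i (s k))) (l (lift i (s j))) /
       bm (xi (l (lift i (s k)))) (xi (l (lift i (s j))))).
  apply: eq_bigr => j _; rewrite tail_prod; apply: eq_bigr => k _.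
  by rewrite !lift_perm_lift.
have -> : \prod_(k < n)
      (bm (nu (lift ord0 k)) (xi (l i)) *
       am (nu ord0) (xi (l (lift_perm ord0 i s (lift ord0 k)))) *
       theta am xi (l (lift_perm ord0 i s (lift ord0 k))) (l i) /
       bm (xi (l (lift_perm ord0 i s (lift ord0 k)))) (xi (l i))) =
    \prod_(k < n) bm (nu (lift ord0 k)) (xi (l i)) *
    \prod_(k < n) (am (nu ord0) (xi (l (lift i k))) *
       theta am xi (l (lift i k)) (l i) / bm (xi (l (lift i k))) (xi (l i))).
  (* The product over the remaining sites is reordered by [s] to match the factors with j = 1. *)
  rewrite [X in _ = _ * X](reindex_inj (@perm_inj _ s)) -big_split /=.
  by apply: eq_bigr => k _; rewrite lift_perm_lift !mulrA.
ring.
Qed.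

End PermutationSum.

Local Open Scope complex_scope.

Theorem proposition9 (R : realType) (Lambda : Type)
    (am bp bm cp cm : Lambda -> Lambda -> R[i])
    (hunit : unitarity (Rmat am bp bm cp cm))
    (hYB : yang_baxter (Rmat am bp bm cp cm))
    (L : nat) (xi : 'I_L -> Lambda)
    (M : nat) (hM : (1 <= M <= L)%N)
    (l : 'I_M -> 'I_L) (hl : forall i j : 'I_M, (i < j)%N -> (l i < l j)%N)
    (nu : 'I_M -> Lambda)
    (hbm : forall i j : 'I_L, i != j -> bm (xi i) (xi j) != 0) :
  ZC (Rmat am bp bm cp cm) xi l nu =
  \sum_(s : 'S_M)
    (\prod_(i < M) cm (nu i) (xi (l (s i)))) *
    \prod_(j < M) \prod_(k < M | (j < k)%N)
      (bm (nu k) (xi (l (s j))) * am (nu j) (xi (l (s k)))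
         * theta am xi (l (s k)) (l (s j))
       / bm (xi (l (s k))) (xi (l (s j)))).
Proof.
(* Writing [M] as [m.+1] makes [inord] available for ['I_M], as [ZC_bra_C] requires. *)
case: M hM l hl nu => // m _ l hl nu.
rewrite ZC_bra_C map_comp bra_C_permutations //.
- exact: yang_baxter_rows.
- exact: unitarity_rows.
Qed.
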